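(* There exists a numerical constant $a>0$ such that $$S(\Lambda_N)\ \ge\ a\sqrt N\,\exp\bigl(-(1+o(1))\lambda(N)\bigr)\quad\text{as } N\to\infty,$$ where $\lambda(x)=\sqrt{\log x\,\log\log x}$.
   Context: $\mathcal{P}_N$ is the set of Dirichlet polynomials $P(s)=\sum_{n=1}^N a_nn^{-s}$ with complex coefficients. For such $P$, $\|P\|_W=\sum_{n=1}^N|a_n|$ and $\|P\|_\infty=\sup_{\operatorname{Re}s>0}|P(s)|=\sup_{t\in\mathbb{R}}|P(it)|$. The Sidon constant of the set $\Lambda_N=\{\log1,\dots,\log N\}$ is $S(\Lambda_N)=\sup_{P\in\mathcal{P}_N,\,P\ne0}\frac{\|P\|_W}{\|P\|_\infty}$. The symbol $o(1)$ denotes a quantity depending only on $N$ that tends to $0$ as $N\to\infty$. *)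

(* Defs.v *)
From HB Require Import structures.
From mathcomp Require Import all_boot all_order all_algebra.
From mathcomp Require Import complex.
From mathcomp Require Import all_classical all_reals all_analysis.

Set Implicit Arguments.
Unset Strict Implicit.
Unset Printing Implicit Defensive.

Import Order.TTheory GRing.Theory Num.Theory.
Import numFieldNormedType.Exports.

Local Open Scope classical_set_scope.
Local Open Scope ring_scope.
Local Open Scope complex_scope.

Definition cexp (R : realType) (z : R[i]) : R[i] :=
  (expR (complex.Re z))%:C *
  (cos (complex.Im z) +i* sin (complex.Im z)).

(* n^{-s} for n >= 1 *)
Definition nat_powN (R : realType) (n : nat) (s : R[i]) : R[i] :=
  cexp (- s * (ln n%:R)%:C).

(* A Dirichlet polynomial sum_{n=1}^N a_n n^{-s} is given by its coefficients,
   which it determines uniquely; [P i] is the coefficient a_{i+1}. *)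
Definition dirichlet_poly (R : realType) (N : nat) := {ffun 'I_N -> R[i]}.

Definition dirichlet_eval (R : realType) (N : nat) (P : dirichlet_poly R N)
    (s : R[i]) : R[i] :=
  \sum_(i < N) P i * nat_powN i.+1 s.

Definition wiener_norm (R : realType) (N : nat) (P : dirichlet_poly R N) : R :=
  \sum_(i < N) Normc.normc (P i).

(* The set is nonempty and bounded above by [wiener_norm P], so this real [sup]
   is a genuine least upper bound. *)
Definition sup_norm (R : realType) (N : nat) (P : dirichlet_poly R N) : R :=
  sup [set Normc.normc (dirichlet_eval P s) | s in
        [set s : R[i] | 0 < complex.Re s]].

(* The Sidon constant of {log 1, ..., log N}, as an extended real so that the
   supremum needs no boundedness side condition. *)
Definition sidon_const (R : realType) (N : nat) : \bar R :=
  ereal_sup [set (wiener_norm P / sup_norm P)%:E | P in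
              [set P : dirichlet_poly R N | P <> [ffun=> 0]]].

Definition lambda (R : realType) (x : R) : R := Num.sqrt (ln x * ln (ln x)).

(* Main.v *)
(* Split the primes up to y, where y^K <= N, into K disjoint blocks of size
   d = 2^r, and give the integer p_1 ... p_K with p_j the x_j-th prime of block
   j the coefficient h(x_1, x_2) h(x_2, x_3) ... h(x_(K-1), x_K), where h is a
   d x d Hadamard matrix.  These d^K integers are distinct and at most N, so
   the Wiener norm is d^K.  Summing over x_1, x_2, ... in turn, every summation
   multiplies the l^2 norm by at most d^(1/2), whence the sup norm is at most
   d^((K+1)/2) and S(Lambda_N) >= d^((K-1)/2).  By Chebyshev's bound one may
   take d >= N^(1/K) / (16 log N), and K close to (log N / log log N)^(1/2)
   gives the result with a = 1. *)
Require Import Defs.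
From HB Require Import structures.
From mathcomp Require Import all_boot all_order all_algebra.
From mathcomp Require Import complex zify ring lra.
From mathcomp Require Import all_classical all_reals all_analysis.

Set Implicit Arguments.
Unset Strict Implicit.
Unset Printing Implicit Defensive.

Import Order.TTheory GRing.Theory Num.Theory.
Import numFieldNormedType.Exports.

(** * A Chebyshev lower bound *)

Definition primes_upto (n : nat) : seq nat := [seq p <- iota 0 n.+1 | prime p].

(** Pascal's rule and symmetry give C(2m+2, m+1) = 2 C(2m+1, m+1) >= 2 C(2m, m). *)
Lemma exp2_le_central_bin (m : nat) : 2 ^ m <= 'C(m.*2, m).
Proof.
elim: m => [|m IHm]; first by rewrite bin0.
have sym : 'C(m.*2.+1, m) = 'C(m.*2.+1, m.+1).
  by rewrite -[RHS]bin_sub; [congr 'C(_, _)|]; lia.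
rewrite doubleS binS -sym addnn expnS mul2n leq_double.
by rewrite sym binS; apply: leq_trans IHm _; rewrite leq_addl.
Qed.

(** By Legendre's formula the exponent is the sum over k of floor(2m/p^k) - 2 floor(m/p^k), where
    each term is at most 1 and vanishes once p^k > 2m. *)
Lemma logn_central_bin (p m : nat) : prime p -> 0 < m ->
  logn p 'C(m.*2, m) <= trunc_log p m.*2.
Proof.
move=> p_pr m_gt0; have p_gt1 := prime_gt1 p_pr.
have m_le : m <= m.*2 by lia.
have /(congr1 (logn p)) := bin_fact m_le.
have -> : m.*2 - m = m by lia.
rewrite lognM ?bin_gt0 ?muln_gt0 ?fact_gt0 // lognM ?fact_gt0 // !logn_fact //.
have -> : \sum_(1 <= k < m.+1) m %/ p ^ k = \sum_(1 <= k < m.*2.+1) m %/ p ^ k.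
  rewrite [RHS](big_cat_nat (n := m.+1)) //=.
  rewrite [X in _ = _ + X]big_nat_cond [X in _ = _ + X]big1 ?addn0 // => k.
  move=> /andP[/andP[lt_mk _] _]; rewrite divn_small //.
  by apply: leq_ltn_trans (ltn_expl k p_gt1); apply: ltnW.
rewrite -big_split /= => E.
have : \sum_(1 <= k < m.*2.+1) m.*2 %/ p ^ k <=
    \sum_(1 <= k < m.*2.+1) (k <= trunc_log p m.*2) +
    \sum_(1 <= k < m.*2.+1) (m %/ p ^ k + m %/ p ^ k).
  rewrite -big_split /=; apply: leq_sum => k _.
  have pk_gt0 : 0 < p ^ k by rewrite expn_gt0; lia.
  case: (leqP k) => [_|lt_k] /=; last first.
    rewrite divn_small //; apply: contraTT lt_k; rewrite -!leqNgt.
    exact: trunc_log_max.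
  rewrite -ltnS ltn_divLR //.
  have := divn_eq m (p ^ k); have := ltn_pmod m pk_gt0.
  by move: (m %/ p ^ k) (m %% p ^ k) (p ^ k) => q r P; nia.
rewrite -E leq_add2r => /leq_trans; apply.
set t := trunc_log _ _; elim: (m.*2) => [|n IHn]; first by rewrite big_geq.
suff: \sum_(1 <= k < n.+2) (k <= t) <= minn n.+1 t by lia.
elim: n.+1 => [|j IHj]; first by rewrite big_geq.
by rewrite big_nat_recr //=; lia.
Qed.

(** The prime powers in the factorization of C(2m, m) are all at most 2m, and hence so are its prime
    divisors. *)
Lemma chebyshev_lower (m : nat) : 0 < m ->
  2 ^ m <= m.*2 ^ size (primes_upto m.*2).
Proof.
move=> m_gt0; apply: leq_trans (exp2_le_central_bin m) _.
set C := 'C(_, _); have C_gt0 : 0 < C by rewrite bin_gt0; lia.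
have pow_le p : prime p -> p ^ logn p C <= m.*2.
  move=> p_pr; have p_gt1 := prime_gt1 p_pr.
  apply: leq_trans (trunc_logP p_gt1 (_ : 0 < m.*2)); last by lia.
  by rewrite leq_exp2l // logn_central_bin.
rewrite {1}(prod_prime_decomp C_gt0) prime_decompE big_map /=.
have -> : m.*2 ^ size (primes_upto m.*2) =
    \prod_(p <- primes_upto m.*2) m.*2.
  by rewrite big_const_seq count_predT iter_muln_1.
apply: (@leq_trans (\prod_(p <- primes C) m.*2)).
  rewrite big_seq [leqRHS]big_seq.
  apply: leq_prod => p; rewrite mem_primes => /andP[p_pr _]; exact: pow_le.
rewrite !big_const_seq !count_predT !iter_muln_1 leq_pexp2l ?double_gt0 //.
apply: uniq_leq_size (primes_uniq C) _ => p p_C.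
have := p_C; rewrite mem_primes => /andP[p_pr _].
rewrite mem_filter p_pr mem_iota /= add0n ltnS.
apply: leq_trans (pow_le p p_pr).
by rewrite -{1}(expn1 p) leq_exp2l ?prime_gt1 // logn_gt0.
Qed.

Lemma size_primes_upto_le (m n : nat) :
  (m <= n)%N -> (size (primes_upto m) <= size (primes_upto n))%N.
Proof.
move=> le_mn; apply: uniq_leq_size => [|p]; first by rewrite filter_uniq ?iota_uniq.
by rewrite !mem_filter !mem_iota => /andP[-> /=]; lia.
Qed.

Local Open Scope classical_set_scope.
Local Open Scope ring_scope.

(** * Products of Hadamard coefficients *)

Section Hadamard.
Variables (C : numClosedFieldType) (r : nat).

(** Sylvester's Hadamard matrix: its rows are the characters of F_2^r. *)
Definition hadamard (x y : {ffun 'I_r -> bool}) : C :=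
  \prod_i (-1) ^+ (x i && y i).

Lemma norm_hadamard x y : `|hadamard x y| = 1.
Proof.
by rewrite normr_prod big1 // => i _; rewrite normrX normrN1 expr1n.
Qed.

Lemma conj_hadamard x y : (hadamard x y)^* = hadamard x y.
Proof. by rewrite rmorph_prod; apply: eq_bigr => i _; rewrite rmorph_sign. Qed.

(** The sum over y factors over the coordinates; one where x and x' differ contributes 1 - 1 = 0,
    any other contributes 2. *)
Lemma hadamard_orthogonal x x' :
  \sum_y hadamard x y * hadamard x' y = (2 ^ r)%:R * (x == x')%:R.
Proof.
transitivity (\sum_(y : {ffun 'I_r -> bool})
    \prod_i ((-1) ^+ (x i && y i) * (-1) ^+ (x' i && y i)) : C).
  by apply: eq_bigr => y _; rewrite -big_split.
rewrite -(bigA_distr_bigA (fun i b => (-1) ^+ (x i && b) * (-1) ^+ (x' i && b))).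
have E i : \sum_(b : bool) (-1) ^+ (x i && b) * (-1) ^+ (x' i && b)
    = if x i == x' i then 2%:R else 0 :> C.
  rewrite big_bool /= !andbT !andbF.
  case: (x i) (x' i) => [] [];
    by rewrite /= !(expr0, expr1, mulrNN, mulr1, mul1r) ?addNr.
rewrite (eq_bigr _ (fun i _ => E i)).
have [<-|neq] := eqVneq x x'.
  rewrite mulr1 (eq_bigr (fun=> 2%:R)) => [|i _]; last by rewrite eqxx.
  by rewrite prodr_const card_ord natrX.
have [i neqi] : exists i, x i != x' i.
  apply/existsP; apply: contraNT neq; rewrite negb_exists => /forallP eqx.
  by apply/eqP/ffunP => i; apply/eqP; have := eqx i; rewrite negbK.
by rewrite mulr0 (bigD1 i) //= (negbTE neqi) mul0r.
Qed.

(** Parseval: once the square is expanded, orthogonality of the rows leaves only the diagonal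
    terms. *)
Lemma hadamard_l2 (v : {ffun 'I_r -> bool} -> C) :
  \sum_y `|\sum_x hadamard x y * v x| ^+ 2 = (2 ^ r)%:R * \sum_x `|v x| ^+ 2.
Proof.
transitivity (\sum_y \sum_x \sum_x'
    (v x * (v x')^*) * (hadamard x y * hadamard x' y)).
  apply: eq_bigr => y _; rewrite normCK rmorph_sum mulr_suml.
  apply: eq_bigr => x _; rewrite mulr_sumr; apply: eq_bigr => x' _.
  by rewrite rmorphM /= conj_hadamard mulrACA mulrC.
rewrite exchange_big mulr_sumr; apply: eq_bigr => x _ /=.
rewrite exchange_big (bigD1 x) //= -mulr_sumr hadamard_orthogonal eqxx.
rewrite big1 ?addr0 => [|x' neq]; first by rewrite normCK mulr1 mulrC.
by rewrite -mulr_sumr hadamard_orthogonal eq_sym (negbTE neq) !mulr0.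
Qed.
End Hadamard.

(** Cauchy-Schwarz against the constant 1, from 2|v_i||v_j| <= |v_i|^2 + |v_j|^2 summed over all
    pairs. *)
Lemma sum_norm_sqr_le (C : numDomainType) (I : finType) (v : I -> C) :
  `|\sum_i v i| ^+ 2 <= #|I|%:R * \sum_i `|v i| ^+ 2.
Proof.
apply: (@le_trans _ _ ((\sum_i `|v i|) ^+ 2)).
  by rewrite lerXn2r ?nnegrE ?sumr_ge0 // ler_norm_sum.
rewrite -(ler_pM2l (ltr0n C 2)).
have -> : 2%:R * (\sum_i `|v i|) ^+ 2 = \sum_i \sum_j `|v i| * `|v j| *+ 2.
  rewrite expr2 mulr_suml mulr_sumr; apply: eq_bigr => i _.
  by rewrite mulr_sumr mulr_sumr; apply: eq_bigr => j _; rewrite mulr_natl.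
have -> : 2%:R * (#|I|%:R * \sum_i `|v i| ^+ 2) =
    \sum_i \sum_j (`|v i| ^+ 2 + `|v j| ^+ 2).
  under [RHS]eq_bigr => i _ do rewrite big_split sumr_const /=.
  by rewrite big_split sumr_const -sumrMnl /= sumrMnl mulr_natl mulr2n mulr_natl.
apply: ler_sum => i _; apply: ler_sum => j _.
by rewrite -subr_ge0 addrAC -sqrrB -real_normK ?rpredB ?normr_real ?exprn_ge0 //.
Qed.

(** * Words, the integers they encode and their exponential sums *)

Section Words.
Variables (C : numClosedFieldType) (D : finType) (h : D -> D -> C).
Variable q : nat -> D -> nat.

(** [word k] has k + 1 letters, so a last letter always exists. Letter x in position j stands for
    the prime [q j x]. *)
Fixpoint word (k : nat) : finType :=
  if k is k'.+1 then (word k' * D)%type : finType else D.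

Definition last_letter (k : nat) : word k -> D :=
  if k is k'.+1 return word k -> D then snd else id.

Fixpoint word_coef (k : nat) : word k -> C :=
  if k is k'.+1 return word k -> C
  then fun t => word_coef t.1 * h (last_letter t.1) t.2 else fun=> 1.

Fixpoint word_prod (k : nat) : word k -> nat :=
  if k is k'.+1 return word k -> nat
  then fun t => (word_prod t.1 * q k'.+1 t.2)%N else q 0.

Lemma card_word k : #|word k| = (#|D| ^ k.+1)%N.
Proof. by elim: k => //= k IHk; rewrite card_prod IHk -expnSr. Qed.

Lemma norm_word_coef k (t : word k) :
  (forall x y, `|h x y| = 1) -> `|word_coef t| = 1.
Proof.
by move=> h1; elim: k t => [|k IHk] t /=; rewrite ?normr1 // normrM IHk h1 mulr1.
Qed.

Lemma word_prod_le k (t : word k) y :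
  (forall j x, j <= k -> q j x <= y)%N -> (word_prod t <= y ^ k.+1)%N.
Proof.
elim: k t => [|k IHk] t le_q /=; first exact: le_q.
by rewrite expnSr leq_mul ?le_q // IHk // => j x jk; apply: le_q; lia.
Qed.

Lemma word_prod_gt0 k (t : word k) :
  (forall j x, j <= k -> prime (q j x))%N -> (0 < word_prod t)%N.
Proof.
elim: k t => [|k IHk] t q_pr /=; first by rewrite prime_gt0 ?q_pr.
rewrite muln_gt0 [X in _ && X]prime_gt0 ?q_pr // andbT IHk // => j x jk.
by apply: q_pr; lia.
Qed.

Lemma dvdn_word_prod k (t : word k) p :
  (forall j x, j <= k -> prime (q j x))%N -> prime p -> (p %| word_prod t)%N ->
  exists j x, (j <= k)%N /\ p = q j x.
Proof.
elim: k t => [|k IHk] t q_pr p_pr /=.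
  by rewrite dvdn_prime2 ?q_pr // => /eqP ->; exists 0%N, t.
rewrite Euclid_dvdM // => /orP[p_dvd|].
  have [|j [x [jk ->]]] := IHk t.1 _ p_pr p_dvd.
    by move=> j x jk; apply: q_pr; lia.
  by exists j, x; split=> //; lia.
by rewrite dvdn_prime2 ?q_pr // => /eqP ->; exists k.+1, t.2.
Qed.

(** The last prime of one product divides the other, where it can only be the last prime, since
    primes of different positions differ; cancel it and induct. *)
Lemma word_prod_inj k :
  (forall j x, j <= k -> prime (q j x))%N ->
  (forall i j x y, i <= k -> j <= k -> q i x = q j y -> i = j /\ x = y)%N ->
  injective (@word_prod k).
Proof.
elim: k => [|k IHk] q_pr q_inj t t' /=.
  by move=> /q_inj[].
have q_pr' j x : (j <= k)%N -> prime (q j x) by move=> jk; apply: q_pr; lia.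
move=> eq_prod; have eq2 : t.2 = t'.2.
  have : (q k.+1 t.2 %| word_prod t'.1 * q k.+1 t'.2)%N.
    by rewrite -eq_prod dvdn_mull.
  rewrite Euclid_dvdM ?q_pr // => /orP[|].
    move=> /(dvdn_word_prod q_pr') [|j [x [jk eq_q]]]; first exact: q_pr.
    have [] : k.+1 = j /\ t.2 = x by apply: q_inj => //; lia.
    by lia.
  by rewrite dvdn_prime2 ?q_pr // => /eqP /q_inj[].
case: t t' eq2 eq_prod => [t x] [t' y] /= <- /eqP.
rewrite eqn_pmul2r ?prime_gt0 ?q_pr // => /eqP/IHk -> // i j u v ik jk.
by apply: q_inj; lia.
Qed.

(** Here [z] abstracts n -> n^(-s). Appending a letter applies [h] to the vector of partial sums,
    which multiplies its squared l^2 norm by at most |D|, then scales each entry by a number of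
    modulus at most 1. *)
Lemma word_sum_l2 k (z : nat -> C) :
  (forall x y, `|h x y| = 1) ->
  (forall v : D -> C,
    \sum_y `|\sum_x h x y * v x| ^+ 2 <= #|D|%:R * \sum_x `|v x| ^+ 2) ->
  (forall j x, j <= k -> prime (q j x))%N ->
  {in [pred n | (0 < n)%N] &, {morph z : m n / (m * n)%N >-> m * n}} ->
  (forall n, (0 < n)%N -> `|z n| <= 1) ->
  \sum_x `|\sum_(t : word k | last_letter t == x) word_coef t * z (word_prod t)|
    ^+ 2 <= #|D|%:R ^+ k.+1.
Proof.
move=> h1 h2 + zM z1; elim: k => [|k IHk] q_pr /=.
  rewrite expr1 -sum1_card natr_sum; apply: ler_sum => x _.
  by rewrite big_pred1_eq mul1r exprn_ile1 // z1 // prime_gt0 ?q_pr.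
have q_pr' j x : (j <= k)%N -> prime (q j x) by move=> jk; apply: q_pr; lia.
rewrite exprS; apply: le_trans (ler_wpM2l _ (IHk q_pr')); last by rewrite ler0n.
apply: le_trans (h2 _); apply: ler_sum => y _.
(* Multiplicativity pulls out the prime of the last letter y; grouping the shorter words by their
   own last letter x leaves the [h]-transform. *)
have -> : \sum_(t : word k * D | t.2 == y)
    word_coef t.1 * h (last_letter t.1) t.2 * z (word_prod t.1 * q k.+1 t.2)%N
  = z (q k.+1 y) * \sum_x h x y * 
    \sum_(t : word k | last_letter t == x) word_coef t * z (word_prod t).
  transitivity (\sum_(t : word k) 
     word_coef t * h (last_letter t) y * z (word_prod t * q k.+1 y)%N).
    rewrite (reindex_onto (fun t => (t, y)) fst) /=; last first.
      by move=> [t x] /= /eqP ->.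
    by apply: eq_bigl => t; rewrite !eqxx.
  rewrite mulr_sumr (partition_big (@last_letter k) predT) //=.
  apply: eq_bigr => x _; rewrite !mulr_sumr; apply: eq_bigr => t /eqP <-.
  rewrite zM ?inE ?word_prod_gt0 ?prime_gt0 ?q_pr //.
  by rewrite !mulrA [_ * z (q _ _)]mulrC !mulrA [z _ * _ * _]mulrAC.
rewrite normrM exprMn ler_piMl ?exprn_ge0 // exprn_ile1 // z1 //.
by rewrite prime_gt0 ?q_pr.
Qed.

(** Summing over the last letter costs one more factor |D| by Cauchy-Schwarz. *)
Lemma word_sum_le k (z : nat -> C) :
  (forall x y, `|h x y| = 1) ->
  (forall v : D -> C,
    \sum_y `|\sum_x h x y * v x| ^+ 2 <= #|D|%:R * \sum_x `|v x| ^+ 2) ->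
  (forall j x, j <= k -> prime (q j x))%N ->
  {in [pred n | (0 < n)%N] &, {morph z : m n / (m * n)%N >-> m * n}} ->
  (forall n, (0 < n)%N -> `|z n| <= 1) ->
  `|\sum_(t : word k) word_coef t * z (word_prod t)| ^+ 2 <= #|D|%:R ^+ k.+2.
Proof.
move=> h1 h2 q_pr zM z1.
rewrite (partition_big (@last_letter k) predT) //= exprS.
apply: le_trans (sum_norm_sqr_le _) _.
by rewrite ler_wpM2l ?ler0n // word_sum_l2.
Qed.
End Words.

(** * Dirichlet polynomials *)

Section DirichletPolynomials.
Local Open Scope complex_scope.
Variable R : realType.

Lemma normcE_real (z : R[i]) : (Normc.normc z)%:C = `|z|.
Proof. by []. Qed.

Lemma normc_le (z : R[i]) (x : R) :
  (Normc.normc z <= x) = (`|z| <= x%:C).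
Proof. by rewrite -normcE_real lecR. Qed.

Lemma cexpD (z w : R[i]) : cexp (z + w) = cexp z * cexp w.
Proof.
case: z w => [a b] [c d]; rewrite /cexp /= expRD cosD sinD.
by simpc; congr (_ +i* _); ring.
Qed.

Lemma cexp0 : cexp (0 : R[i]) = 1.
Proof. by rewrite /cexp /= expR0 cos0 sin0 mul1r. Qed.

Lemma norm_cexp (z : R[i]) :
  `|cexp z| = (expR (complex.Re z))%:C.
Proof.
rewrite /cexp normrM normc_def /= expr0n addr0 sqrtr_sqr ger0_norm ?expR_ge0 //.
by rewrite normc_def /= cos2Dsin2 sqrtr1 mulr1.
Qed.

Lemma nat_powNM (m n : nat) (s : R[i]) : (0 < m)%N -> (0 < n)%N ->
  nat_powN (m * n) s = nat_powN m s * nat_powN n s.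
Proof.
move=> m_gt0 n_gt0; rewrite /nat_powN -cexpD natrM lnM ?posrE ?ltr0n //.
by rewrite rmorphD mulrDr.
Qed.

Lemma norm_nat_powN_le1 (n : nat) (s : R[i]) :
  (0 < n)%N -> 0 < complex.Re s -> `|nat_powN n s| <= 1.
Proof.
move=> n_gt0; case: s => [a b] /= a_gt0; rewrite norm_cexp /= mulr0 subr0.
rewrite lecR -[leRHS]expR0 ler_expR mulNr oppr_le0 mulr_ge0 ?(ltW a_gt0) //.
by rewrite ln_ge0 ?ler1n.
Qed.

Lemma nat_powN_nat (n j : nat) :
  (0 < n)%N -> nat_powN n (j%:R : R[i]) = ((n%:R : R)^-1)%:C ^+ j.
Proof.
move=> n_gt0; rewrite /nat_powN; elim: j => [|j IHj].
  by rewrite oppr0 mul0r cexp0 expr0.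
rewrite -natr1 opprD mulrDl cexpD IHj exprSr; congr (_ * _).
rewrite mulN1r /cexp /= oppr0 cos0 sin0 expRN lnK ?posrE ?ltr0n //.
by rewrite mulr1.
Qed.

(** * The sup norm and lower bounds for the Sidon constant *)

Section SupNorm.
Variable N : nat.
Implicit Types P : dirichlet_poly R N.

Lemma dirichlet_eval_le_wiener P (s : R[i]) :
  0 < complex.Re s -> Normc.normc (dirichlet_eval P s) <= wiener_norm P.
Proof.
move=> s_gt0; rewrite normc_le; apply: le_trans (ler_norm_sum _ _ _) _.
rewrite rmorph_sum /=; apply: ler_sum => i _.
by rewrite normrM normcE_real ler_piMr // norm_nat_powN_le1.
Qed.

Lemma has_sup_dirichlet P :
  has_sup [set Normc.normc (dirichlet_eval P s) | s in
            [set s : R[i] | 0 < complex.Re s]].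
Proof.
split; first by exists (Normc.normc (dirichlet_eval P 1)), 1 => //=; rewrite ltr01.
by exists (wiener_norm P) => _ [s s_gt0 <-]; apply: dirichlet_eval_le_wiener.
Qed.

Lemma sup_norm_le P (B : R) :
  (forall s : R[i], 0 < complex.Re s -> Normc.normc (dirichlet_eval P s) <= B) ->
  sup_norm P <= B.
Proof.
move=> leB; apply: ge_sup; first by case: (has_sup_dirichlet P).
by move=> _ [s s_gt0 <-]; apply: leB.
Qed.

(* If [P] vanished at the points 1, ..., N, its coefficients would be killed by
   an invertible Vandermonde matrix with nodes 1/n. *)
Lemma sup_norm_gt0 P : P <> [ffun=> 0] -> 0 < sup_norm P.
Proof.
move=> P_neq0; have [j Pj_neq0] : exists j : nat, dirichlet_eval P j.+1%:R != 0.
  apply: contra_notP P_neq0 => /forallNP P0.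
  have {}P0 j : dirichlet_eval P j.+1%:R = 0.
    by apply/eqP; have /negP := P0 j; rewrite negbK.
  pose x : 'rV[R[i]]_N := \row_i ((i.+1%:R : R)^-1)%:C.
  (* The extra factor [x 0 i] is needed because Vandermonde exponents start at 0 while the
     evaluation points start at 1, inside the half-plane. *)
  pose u : 'cV[R[i]]_N := \col_i (P i * x 0 i).
  have Vu0 : Vandermonde N x *m u = 0.
    apply/matrixP => j k; rewrite !mxE -[RHS](P0 j); apply: eq_bigr => i _.
    by rewrite !mxE nat_powN_nat // exprSr mulrCA.
  have V_unit : Vandermonde N x \in unitmx.
    rewrite unitmxE det_Vandermonde unitfE; apply/prodf_neq0 => i _.
    apply/prodf_neq0 => j lt_ij; rewrite !mxE subr_eq0; apply/negP => /eqP.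
    move=> /complexI /invr_inj /eqP; rewrite eqr_nat => /eqP[] eq_ij.
    by move: lt_ij; rewrite eq_ij ltnn.
  have u0 : u = 0 by rewrite -(mulKmx V_unit u) Vu0 mulmx0.
  apply/ffunP => i; rewrite ffunE; have /matrixP/(_ i 0) := u0.
  rewrite !mxE => /eqP; rewrite mulf_eq0 => /orP[/eqP//|].
  by rewrite fmorph_eq0 invr_eq0 pnatr_eq0.
apply: (@lt_le_trans _ _ (Normc.normc (dirichlet_eval P j.+1%:R))).
  by rewrite -ltcR normcE_real normr_gt0.
apply: (sup_upper_bound (has_sup_dirichlet P)); exists j.+1%:R => //=.
by rewrite raddfMn /= ltr0n.
Qed.

Lemma le_sidon_const P (W B : R) : P <> [ffun=> 0] -> 0 <= W ->
  W <= wiener_norm P -> sup_norm P <= B -> ((W / B)%:E <= sidon_const R N)%E.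
Proof.
move=> P_neq0 W_ge0 leW leB; have P_gt0 := sup_norm_gt0 P_neq0.
apply: (@le_trans _ _ (wiener_norm P / sup_norm P)%:E); last first.
  by apply: ereal_sup_ubound; exists P.
rewrite lee_fin; apply: ler_pM => //.
  by rewrite invr_ge0 (le_trans (ltW P_gt0)).
by rewrite lef_pV2 ?posrE // (lt_le_trans P_gt0).
Qed.
End SupNorm.

Lemma sidon_const_ge (N y r k : nat) :
  (y ^ k.+1 <= N)%N -> (k.+1 * 2 ^ r <= size (primes_upto y))%N ->
  ((Num.sqrt ((2 ^ r)%:R ^+ k))%:E <= sidon_const R N)%E.
Proof.
move=> le_yN le_pi; pose D := {ffun 'I_r -> bool}.
have cardD : #|D| = (2 ^ r)%N by rewrite card_ffun card_bool card_ord.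
have rank_lt (x : D) : (enum_rank x < 2 ^ r)%N by rewrite -cardD.
pose idq (j : nat) (x : D) := (j * 2 ^ r + enum_rank x)%N.
(* Block j consists of 2^r consecutive primes. The default 2 is never reached for j <= k, by
   [idq_lt]. *)
pose q j x := nth 2%N (primes_upto y) (idq j x).
have idq_lt j x : (j <= k)%N -> (idq j x < size (primes_upto y))%N.
  move=> jk; apply: leq_trans le_pi; rewrite /idq; have := rank_lt x.
  by move: (2 ^ r)%N (enum_rank x : nat) => d e; nia.
have q_in j x : (j <= k)%N -> q j x \in primes_upto y.
  by move=> jk; rewrite mem_nth ?idq_lt.
have q_pr j x : (j <= k)%N -> prime (q j x).
  by move=> jk; have := q_in j x jk; rewrite mem_filter => /andP[].
have q_le j x : (j <= k)%N -> (q j x <= y)%N.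
  by move=> jk; have := q_in j x jk; rewrite mem_filter mem_iota ltnS => /andP[].
have q_inj i j x x' : (i <= k)%N -> (j <= k)%N -> q i x = q j x' -> i = j /\ x = x'.
  move=> ik jk /eqP; rewrite nth_uniq ?idq_lt ?filter_uniq ?iota_uniq // => /eqP.
  rewrite /idq => eq_id; have d_gt0 : (0 < 2 ^ r)%N by rewrite expn_gt0.
  (* Quotient and remainder by 2^r recover the block and the letter. *)
  split; first by have /(congr1 (divn^~ (2 ^ r)%N)) := eq_id;
    rewrite !divnMDl // !divn_small ?rank_lt // !addn0.
  have /(congr1 (modn^~ (2 ^ r)%N)) := eq_id.
  by rewrite !modnMDl !modn_small ?rank_lt // => /ord_inj/enum_rank_inj.
pose h : D -> D -> R[i] := @hadamard R[i] r.
have h1 x x' : `|h x x'| = 1 by apply: norm_hadamard.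
have h2 (v : D -> R[i]) :
    \sum_x' `|\sum_x h x x' * v x| ^+ 2 <= #|D|%:R * \sum_x `|v x| ^+ 2.
  by rewrite hadamard_l2 cardD.
pose val (t : word D k) := word_prod q t.
have val_gt0 t : (0 < val t)%N by apply: word_prod_gt0.
(* Index i carries the coefficient of i + 1, hence the predecessor. *)
have val_le t : ((val t).-1 < N)%N.
  by rewrite prednK // (leq_trans _ le_yN) // word_prod_le.
pose idx t := Ordinal (val_le t).
have idxS t : (idx t).+1 = val t by rewrite /= prednK.
have idx_inj : injective idx.
  move=> t t' eq_idx; apply: (word_prod_inj q_pr q_inj).
  by rewrite -/(val t) -/(val t') -!idxS eq_idx.
(* By injectivity each sum has at most one term; it is 0 at integers that come from no word. *)
pose P : dirichlet_poly R N := [ffun i => \sum_(t | idx t == i) word_coef h t].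
have PE t : P (idx t) = word_coef h t.
  by rewrite ffunE (big_pred1 t) // => t' /=; rewrite (inj_eq idx_inj).
have W_le : (2 ^ r)%:R ^+ k.+1 <= wiener_norm P.
  rewrite -natrX -cardD -card_word -sum1_card natr_sum (partition_big idx predT) //=.
  apply: ler_sum => i _; case: (pickP [pred t | idx t == i]) => [t /= /eqP <-|none].
    rewrite (big_pred1 t) => [|t' /=]; last by rewrite (inj_eq idx_inj).
    by rewrite -lecR normcE_real PE norm_word_coef.
  by rewrite big_pred0 // -lecR normcE_real normr_ge0.
have d_ge0 n : 0 <= (2 ^ r)%:R ^+ n :> R by rewrite exprn_ge0.
have d_gt0 n : 0 < (2 ^ r)%:R ^+ n :> R by rewrite exprn_gt0 // ltr0n expn_gt0.
have B_ge : sup_norm P <= Num.sqrt ((2 ^ r)%:R ^+ k.+2).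
  apply: sup_norm_le => s s_gt0.
  rewrite -(ler_sqr (x := Normc.normc _)) ?nnegrE ?sqrtr_ge0 //; last first.
    by rewrite -lecR normcE_real normr_ge0.
  rewrite sqr_sqrtr // -lecR !rmorphXn /= normcE_real rmorph_nat -cardD.
  suff -> : dirichlet_eval P s =
      \sum_(t : word D k) word_coef h t * nat_powN (word_prod q t) s.
    apply: (word_sum_le (z := fun n => nat_powN n s)) => //
      [m n m_gt0 n_gt0|n n_gt0].
      exact: nat_powNM.
    exact: norm_nat_powN_le1.
  rewrite (partition_big idx predT) //=; apply: eq_bigr => i _.
  by rewrite ffunE mulr_suml; apply: eq_bigr => t /eqP <-; rewrite idxS.
have P_neq0 : P <> [ffun=> 0].
  move=> P0; move: W_le; rewrite P0 /wiener_norm big1 ?leNgt ?d_gt0 // => i _.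
  by rewrite ffunE Normc.normc0.
apply: le_trans (le_sidon_const P_neq0 (d_ge0 _) W_le B_ge).
(* With d = 2^r this is d^(k/2) d^((k+2)/2) = d^(k+1). *)
rewrite lee_fin ler_pdivlMr ?sqrtr_gt0 // -sqrtrM // -exprD.
have -> : (k + k.+2 = k.+1 * 2)%N by lia.
by rewrite exprM sqrtr_sqr ger0_norm.
Qed.
End DirichletPolynomials.

(** * Choice of the parameters *)

(** From exp(-1/2) >= 1 - 1/2 follows exp(1/2) <= 2. *)
Lemma ln2_ge (R : realType) : 2^-1 <= ln (2 : R).
Proof.
rewrite -ler_expR lnK ?posrE ?ltr0n //.
have e_gt0 := expR_gt0 (2^-1 : R); have := expR_ge1Dx (- 2^-1 : R).
by rewrite expRN -[_^-1 in leRHS]mul1r ler_pdivlMr //; lra.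
Qed.

Lemma prime_count_ge (R : realType) (Y : R) : 4 <= Y ->
  Y / 8 <= (size (primes_upto (Num.truncn Y)))%:R * ln Y.
Proof.
move=> Y_ge4; have Y_ge0 : 0 <= Y by lra.
have /andP[y_le y_gt] := truncn_itv Y_ge0; set y := Num.truncn Y in y_le y_gt *.
have y_ge4 : (4 <= y)%N by rewrite -ltnS -(ltr_nat R); apply: le_lt_trans y_gt.
pose m := y./2; have m_gt0 : (0 < m)%N by rewrite /m; lia.
have m2_le : (m.*2 <= y)%N by rewrite /m; lia.
have y_le_m : (y <= m.*2.+1)%N by rewrite /m; lia.
have m2_gt0 : 0 < m.*2%:R :> R by rewrite ltr0n double_gt0.
have : ln ((2 ^ m)%:R : R) <= ln ((m.*2 ^ size (primes_upto m.*2))%:R : R).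
  rewrite ler_ln ?posrE ?ltr0n ?expn_gt0 ?double_gt0 ?m_gt0 //.
  by rewrite ler_nat chebyshev_lower.
rewrite !natrX !lnXn ?ltr0n ?double_gt0 //.
rewrite -[ln 2 *+ m]mulr_natl -[ln _ *+ size _]mulr_natl => cheb.
have le_ln : ln (m.*2%:R : R) <= ln Y.
  by rewrite ler_ln ?posrE //; [apply: le_trans y_le; rewrite ler_nat | lra].
have ln_m2 : 0 <= ln (m.*2%:R : R) by rewrite ln_ge0 // ler1n; lia.
(* Since m >= (Y - 2)/2 and ln 2 >= 1/2, m ln 2 is at least (Y - 2)/4, which is at least Y/8 because
   Y >= 4. *)
apply: (@le_trans _ _ (m%:R * ln 2)).
  have := ln2_ge R; have : Y <= m%:R * 2 + 2.
    apply: ltW; apply: lt_le_trans y_gt _.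
    by rewrite -natrM -natrD ler_nat; lia.
  by nra.
apply: le_trans cheb _; apply: ler_pM => //.
by rewrite ler_nat size_primes_upto_le.
Qed.

(** With K = k + 1 and Y = N^(1/K), ln Y = L/K yields at least K Y/(8 L) primes up to Y. Rounding
    the block size down to a power of two loses at most a factor 2, whence 16. *)
Lemma sidon_const_ge_root (R : realType) (N k : nat) (L := ln (N%:R : R)) :
  1 <= L -> 8 * L <= expR (L / k.+1%:R) ->
  ((Num.sqrt ((expR (L / k.+1%:R) / (16 * L)) ^+ k))%:E <= sidon_const R N)%E.
Proof.
move=> L_ge1; set Y := expR _ => Y_ge.
have N_gt0 : (0 < N)%N.
  by rewrite lt0n; apply: contraTneq L_ge1 => N0; rewrite /L N0 ln0 // -ltNge ltr01.
have K_gt0 : 0 < k.+1%:R :> R by rewrite ltr0n.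
have Y_ge0 : 0 <= Y by rewrite expR_ge0.
have le_yN : (Num.truncn Y ^ k.+1 <= N)%N.
  rewrite -(ler_nat R) natrX.
  apply: (@le_trans _ _ (Y ^+ k.+1)); first by rewrite lerXn2r ?nnegrE // truncn_le.
  by rewrite -expRM_natr divfK ?gt_eqF // lnK // posrE ltr0n.
have := @prime_count_ge R Y; set pi := size _ => pi_ge.
have {}pi_ge : k.+1%:R * (Y / (8 * L)) <= pi%:R.
  have : Y / 8 <= pi%:R * ln Y by apply: pi_ge; lra.
  rewrite expRK => h; have L_gt0 : 0 < L by lra.
  rewrite mulrA ler_pdivrMr ?mulr_gt0 //.
  move: h; rewrite mulrA ler_pdivlMr //.
  by lra.
(* The hypothesis 8 L <= Y guarantees at least one prime per block. *)
have K_le_pi : (k.+1 <= pi)%N.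
  rewrite -(ler_nat R); apply: le_trans pi_ge; rewrite ler_peMr //.
  by rewrite ler_pdivlMr; lra.
pose r := trunc_log 2 (pi %/ k.+1).
have q_gt0 : (0 < pi %/ k.+1)%N by rewrite divn_gt0.
have r_le : (k.+1 * 2 ^ r <= pi)%N.
  by rewrite mulnC -leq_divRL // trunc_logP.
have r_gt : (pi < k.+1 * (2 * 2 ^ r))%N.
  by rewrite -expnS mulnC -ltn_divLR // trunc_log_ltn.
apply: le_trans (sidon_const_ge R le_yN r_le).
move: (2 ^ r)%N r_gt => d; rewrite -(ltr_nat R) !natrM => r_gt.
have d_ge : Y / (16 * L) <= d%:R.
  have : k.+1%:R * (Y / (8 * L)) <= k.+1%:R * (2 * d%:R).
    exact: le_trans pi_ge (ltW r_gt).
  rewrite ler_pM2l // ler_pdivrMr; last by lra.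
  by rewrite ler_pdivrMr; lra.
rewrite lee_fin ler_wsqrtr // lerXn2r // nnegrE ?ler0n //.
by rewrite divr_ge0 //; lra.
Qed.

Lemma sqrt_expR (R : realType) (x : R) : Num.sqrt (expR x) = expR (x / 2).
Proof.
rewrite -[x in LHS](divfK (_ : 2 != 0)) ?pnatr_eq0 // expRM_natr sqrtr_sqr.
by rewrite ger0_norm ?expR_ge0.
Qed.

(** * Limits of the parameters and the final estimate *)

Lemma ln_cvgy (R : realType) : @ln R x @[x --> +oo] --> +oo.
Proof.
apply/cvgryPge => A; near=> x; have x_gt0 : 0 < x by near: x; exact: nbhs_pinfty_gt.
rewrite -ler_expR lnK ?posrE //; near: x; exact: nbhs_pinfty_ge.
Unshelve. all: by end_near. Qed.

(** With x = e^(2y), the bound e^y >= 1 + y gives x >= y^2, whereas ln x = 2y; so y >= 2A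
    suffices. *)
Lemma div_ln_cvgy (R : realType) : x / @ln R x @[x --> +oo] --> +oo.
Proof.
apply/cvgryPge => A; near=> x.
have x_gt1 : 1 < x by near: x; exact: nbhs_pinfty_gt.
have lnx_gt0 : 0 < ln x by rewrite ln_gt0.
rewrite ler_pdivlMr //; pose y := ln x / 2.
have xE : expR y * expR y = x by rewrite -expRD /y -splitr lnK // posrE; lra.
have lnxE : ln x = 2 * y by rewrite /y; lra.
have y_ge : 2 * A <= y.
  rewrite /y ler_pdivlMr // -ler_expR lnK ?posrE; last by lra.
  by near: x; exact: nbhs_pinfty_ge.
have y_gt0 : 0 < y by rewrite /y divr_gt0.
by rewrite lnxE -[leRHS]xE; have := expR_ge1Dx y; nra.
Unshelve. all: by end_near. Qed.

(** The real K minimising L/K + K ln L, where L = ln N; both terms then equal lambda(N). The number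
    of blocks is its integer part. *)
Definition kappa (R : realType) (N : nat) : R :=
  Num.sqrt (ln N%:R / ln (ln N%:R)).

(** The explicit o(1): the first term pays for rounding [kappa] to an integer, the second for the
    constant 16 in the block size. *)
Definition sidon_eps (R : realType) (N : nat) : R :=
  2^-1 * ((kappa R N - 1)^-1 + ln 16 * (ln (ln N%:R))^-1).

Lemma ln_ln_cvgy (R : realType) : (ln (ln N%:R) : R) @[N --> \oo] --> +oo.
Proof.
apply: cvg_comp (@ln_cvgy R); apply: cvg_comp (@ln_cvgy R); exact: cvgr_idn.
Qed.

Lemma kappa_cvgy (R : realType) : kappa R N @[N --> \oo] --> +oo.
Proof.
have h : (ln N%:R / ln (ln N%:R) : R) @[N --> \oo] --> +oo.
  apply: cvg_comp (@div_ln_cvgy R); apply: cvg_comp (@ln_cvgy R); exact: cvgr_idn.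
apply/cvgryPge => A; near=> N; apply: (le_trans (ler_norm A)).
rewrite -sqrtr_sqr /kappa ler_wsqrtr //.
by near: N; move: h => /cvgryPge; apply.
Unshelve. all: by end_near. Qed.

Lemma sidon_eps_cvg0 (R : realType) : sidon_eps R N @[N --> \oo] --> (0 : R).
Proof.
rewrite -[X in _ --> X](mulr0 2^-1); apply: cvgMr.
rewrite -[X in _ --> X]addr0; apply: cvgD.
  apply/gtr0_cvgV0.
    near=> N; rewrite subr_gt0; near: N.
    by move: (@kappa_cvgy R) => /cvgryPgt; apply.
  apply/cvgryPge => A; near=> N; rewrite lerBrDr; near: N.
  by move: (@kappa_cvgy R) => /cvgryPge; apply.
rewrite -[X in _ --> X](mulr0 (ln 16)); apply: cvgMr.
apply/gtr0_cvgV0; last exact: ln_ln_cvgy.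
by move: (@ln_ln_cvgy R) => /cvgryPgt; apply.
Unshelve. all: by end_near. Qed.

Lemma sidon_const_ge_eps (R : realType) (N : nat) :
  ln 16 <= ln (ln N%:R) :> R -> 4 <= kappa R N ->
  ((Num.sqrt N%:R * expR (- ((1 + sidon_eps R N) * lambda (N%:R : R))))%:E
    <= sidon_const R N)%E.
Proof.
rewrite /sidon_eps /lambda; set L := ln N%:R; set l := ln L; set c := ln 16.
set x := kappa R N => l_ge x_ge.
have c_gt0 : 0 < c by rewrite ln_gt0 // ltr1n.
have l_gt0 : 0 < l by lra.
have L_gt1 : 1 < L.
  by rewrite ltNge; apply: contraTN l_gt0 => /ln_le0; rewrite -leNgt.
have N_gt0 : (0 < N)%N.
  by rewrite lt0n; apply: contraTneq L_gt1 => N0; rewrite /L N0 ln0 // -leNgt ler01.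
have expL : expR L = N%:R by rewrite lnK // posrE ltr0n.
have expl : expR l = L by rewrite lnK // posrE; lra.
have expc : expR c = 16 by rewrite lnK // posrE ltr0n.
have LE : L = x ^+ 2 * l.
  by rewrite sqr_sqrtr ?divfK ?gt_eqF ?divr_ge0 -/L -/l //; lra.
have -> : Num.sqrt (L * l) = x * l.
  rewrite LE -mulrA -expr2 -exprMn sqrtr_sqr ger0_norm ?mulr_ge0 //; lra.
have x_ge0 : 0 <= x by lra.
have /andP[] := truncn_itv x_ge0.
case EK: (Num.truncn x) => [|k] K_le K_gt; first by exfalso; lra.
have K_gt0 : 0 < k.+1%:R :> R by rewrite ltr0n.
have LK_ge : x * l <= L / k.+1%:R by rewrite ler_pdivlMr // LE; nra.
(* Here 16 L = e^(c + l) and c + l <= 2 l <= x l <= L/K, with K = k + 1 the integer part of x. *)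
have Y_ge : 16 * L <= expR (L / k.+1%:R).
  rewrite -expl -expc -expRD ler_expR expl.
  have x4 : 4 * l <= x * l by rewrite ler_pM2r.
  by apply: (le_trans _ LK_ge); lra.
have Y_ge8 : 8 * L <= expR (L / k.+1%:R) by apply: (le_trans _ Y_ge); lra.
apply: le_trans (sidon_const_ge_root (ltW L_gt1) Y_ge8).
rewrite -/L.
have -> : expR (L / k.+1%:R) / (16 * L) = expR (L / k.+1%:R - (c + l)).
  by rewrite expRB expRD expl expc.
rewrite -expRM_natr sqrt_expR -expL sqrt_expR -expRD lee_fin ler_expR.
have kE : k%:R = k.+1%:R - 1 :> R by rewrite -natr1 addrK.
(* K > x - 1 bounds L/K by L/(x - 1) = x^2 l/(x - 1). *)
have LK_le : L / k.+1%:R <= x * l + x * l / (x - 1).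
  have -> : x * l + x * l / (x - 1) = L / (x - 1) by rewrite LE; field; lra.
  rewrite ler_pM2l; last by lra.
  rewrite lef_pV2 ?posrE //; last by lra.
  by move: K_gt; rewrite -natr1; lra.
have eqK : L / k.+1%:R * k.+1%:R = L by rewrite divfK // gt_eqF.
have epsE : (1 + 2^-1 * ((x - 1)^-1 + c * l^-1)) * (x * l) =
    x * l + 2^-1 * (x * l / (x - 1) + c * x) by field; lra.
rewrite epsE kE; move: (L / k.+1%:R) (x * l / (x - 1)) eqK LK_le => u v eqK LK_le.
(* With K = k + 1 and u K = L, the claim becomes u + (K - 1)(c + l) <= 2 x l + v + c x, which
   follows from u <= x l + v and K - 1 <= x. *)
nra.
Qed.

Theorem theorem3p2 (R : realType) :
  exists2 a : R, 0 < a &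
    exists2 eps : nat -> R, eps @ \oo --> (0 : R) &
      \forall N \near \oo,
        ((a * Num.sqrt N%:R * expR (- ((1 + eps N) * lambda (N%:R : R))))%:E
          <= sidon_const R N)%E.
Proof.
exists 1; first exact: ltr01.
exists (sidon_eps R); first exact: (@sidon_eps_cvg0 R).
near=> N; rewrite mul1r; apply: sidon_const_ge_eps; near: N.
  by move: (@ln_ln_cvgy R) => /cvgryPge; apply.
by move: (@kappa_cvgy R) => /cvgryPge; apply.
Unshelve. all: by end_near. Qed.
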